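(* Let $\mathscr{V}$ be a locally additive bicategory whose hom categories have finite direct sums, let $\mathscr{D}$ be a differential system on $\mathscr{V}$, and let $\mathscr{G}$ be the associated differential comonad on $\mathscr{V}$ in $\mathrm{Caten}$. The bicategory $\mathscr{V}^{\mathscr{G}}$ has (up to canonical identification) the following description. Its objects are those of $\mathscr{D}$. The objects of the hom category $\mathscr{V}^{\mathscr{G}}(D,D')$ are pairs $(x,\delta)$ where $x:D_0\to D'_0$ is a morphism and $\delta:x\Rightarrow\mathscr{D}_D^{D'}(x)$ is a 2-cell of $\mathscr{V}$ satisfying $\mathscr{D}_D^{D'}(\delta)\,\delta=0$. Morphisms $\theta:(x,\delta)\Rightarrow(x_1,\delta_1)$ are 2-cells $\theta:x\Rightarrow x_1$ in $\mathscr{V}$ such that $\mathscr{D}_D^{D'}(\theta)\,\delta=\delta_1\,\theta$. The composite of $(x,\delta):D\to D'$ and $(x',\delta'):D'\to D''$ is $$\big(x'\otimes x,\ \mathrm{r}_{x',x}(\delta'\otimes1_x)+\ell_{x',x}(1_{x'}\otimes\delta)\big):D\to D''.$$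
   Context: Notation. For a bicategory $\mathscr V$, $\mathscr V_V^{V'}=\mathscr V(V,V')$ is the hom category; horizontal composition is written $\otimes$ (so $v'\otimes v:V\to V''$ for $v:V\to V'$, $v':V'\to V''$); associativity and unit constraints are suppressed. $\mathscr V$ is locally additive when its homs are additive categories and composition with a morphism on either side is an additive functor. Differential system. A differential system $\mathscr D$ on $\mathscr V$ consists of a set $\mathrm{ob}\mathscr D$, a function $(-)_0:\mathrm{ob}\mathscr D\to\mathrm{ob}\mathscr V$, additive functors $\mathscr D_D^{D'}:\mathscr V_{D_0}^{D'_0}\to\mathscr V_{D_0}^{D'_0}$ for all $D,D'\in\mathrm{ob}\mathscr D$, and families of 2-cells, natural in $v\in\mathscr V_{D_0}^{D'_0}$ and $v'\in\mathscr V_{D'_0}^{D''_0}$, $$\mathrm r_{v',v}:\mathscr D_{D'}^{D''}(v')\otimes v\to\mathscr D_D^{D''}(v'\otimes v),\qquad\ell_{v',v}:v'\otimes\mathscr D_D^{D'}(v)\to\mathscr D_D^{D''}(v'\otimes v),$$ such that, writing also $v''\in\mathscr V_{D''_0}^{D'''_0}$: (1) $\mathrm r_{v''\otimes v',v}\circ(\mathrm r_{v'',v'}\otimes1_v)=\mathrm r_{v'',v'\otimes v}$; (2) $\ell_{v'',v'\otimes v}\circ(1_{v''}\otimes\ell_{v',v})=\ell_{v''\otimes v',v}$; (3) $\mathrm r_{v''\otimes v',v}\circ(\ell_{v'',v'}\otimes1_v)=\ell_{v'',v'\otimes v}\circ(1_{v''}\otimes\mathrm r_{v',v})$; (4) $\mathrm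 r_{v,1_{D_0}}$ and $\ell_{1_{D'_0},v}$ are the identity of $\mathscr D_D^{D'}(v)$ (modulo unit constraints); (5) $\mathscr D_D^{D''}(\ell_{v',v})\circ\mathrm r_{v',\mathscr D_D^{D'}(v)}+\mathscr D_D^{D''}(\mathrm r_{v',v})\circ\ell_{\mathscr D_{D'}^{D''}(v'),v}=0$. Comonads in Caten. ($\mathrm{Caten}$ is the tricategory of bicategories, 2-sided enriched categories, enriched functors and enriched natural transformations; what is needed here is the following.) A comonad $\mathscr G$ on $\mathscr V$ in $\mathrm{Caten}$ amounts to: a set $\mathrm{Ob}\mathscr G$ with a function $G\mapsto G_0\in\mathrm{Ob}\mathscr V$; endofunctors $\mathscr G_G^{G'}$ of $\mathscr V_{G_0}^{G'_0}$; and natural 2-cells $\mu_{v',v}:\mathscr G_{G'}^{G''}(v')\otimes\mathscr G_G^{G'}(v)\to\mathscr G_G^{G''}(v'\otimes v)$, $\eta_G:1_{G_0}\to\mathscr G_G^G(1_{G_0})$, $\mathrm d_v:\mathscr G_G^{G'}v\to\mathscr G_G^{G'}\mathscr G_G^{G'}v$, $\mathrm e_v:\mathscr G_G^{G'}v\to v$ such that $(\mu,\eta)$ satisfies associativity and unit laws, each $(\mathscr G_G^{G'},\mathrm e,\mathrm d)$ is a comonad, and $\mathrm d,\mathrm e$ are compatible with $\mu,\eta$. The bicategory $\mathscr V^{\mathscr G}$ has objects $\mathrm{Ob}\mathscr G$ and homs $\mathscr V^{\mathscr G}(G,G')$ the Eilenberg–Moore coalgebras $(v,\gamma_v)$ for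 the comonad $\mathscr G_G^{G'}$ on $\mathscr V_{G_0}^{G'_0}$; identities are $(1_{G_0},\eta_G)$ and $(v',\gamma_{v'})\otimes(v,\gamma_v)=(v'\otimes v,\mu_{v',v}(\gamma_{v'}\otimes\gamma_v))$. The differential comonad of $\mathscr D$. $\mathrm{Ob}\mathscr G=\mathrm{ob}\mathscr D$ with $D\mapsto D_0$; $\mathscr G_D^{D'}=1\oplus\mathscr D_D^{D'}$; $\mu_{v',v}$ is the matrix $\begin{bmatrix}1&0&0&0\\0&\ell_{v',v}&\mathrm r_{v',v}&0\end{bmatrix}$ from $(v'\otimes v)\oplus(v'\otimes\mathscr D(v))\oplus(\mathscr D(v')\otimes v)\oplus(\mathscr D(v')\otimes\mathscr D(v))$ to $(v'\otimes v)\oplus\mathscr D(v'\otimes v)$; $\eta_D$ is the first injection; $\mathrm d_v=\begin{bmatrix}1&0\\0&1\\0&1\\0&0\end{bmatrix}:v\oplus\mathscr D(v)\Rightarrow v\oplus\mathscr D(v)\oplus\mathscr D(v)\oplus\mathscr D^2(v)$; $\mathrm e_v$ is the first projection. *)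

(* Defs.v *)
From HB Require Import structures.
From mathcomp Require Import all_boot all_algebra.
From mathcomp Require Import boolp.

Set Implicit Arguments.
Unset Strict Implicit.
Unset Printing Implicit Defensive.

Import GRing.Theory.
Local Open Scope ring_scope.

Reserved Notation "g \oc f" (at level 40, left associativity).
Reserved Notation "g \ox f" (at level 38, left associativity).
Reserved Notation "t \ox2 s" (at level 38, left associativity).

Record category := Category {
  ob :> Type;
  mor : ob -> ob -> Type;
  idmor : forall x, mor x x;
  mcomp : forall x y z, mor y z -> mor x y -> mor x z;
  mcompA : forall w x y z (h : mor y z) (g : mor x y) (f : mor w x),
    mcomp h (mcomp g f) = mcomp (mcomp h g) f;
  mcomp1m : forall x y (f : mor x y), mcomp (idmor y) f = f;
  mcompm1 : forall x y (f : mor x y), mcomp f (idmor x) = f }.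

Notation "g \oc f" := (mcomp g f).

(* A morphism packed with its source and target: equality in this type compares
   morphisms whose endpoints are only propositionally equal. *)
Definition arr (C : category) (x y : C) (f : mor x y) :
    {p : C * C & mor p.1 p.2} :=
  existT (fun p : C * C => mor p.1 p.2) (x, y) f.

Record functor (C D : category) := Functor {
  fob :> C -> D;
  fmap : forall x y : C, mor x y -> mor (fob x) (fob y);
  fmap1 : forall x : C, fmap (idmor x) = idmor (fob x);
  fmapM : forall (x y z : C) (g : mor y z) (f : mor x y),
    fmap (g \oc f) = fmap g \oc fmap f }.

Record comonad (C : category) := Comonad {
  cmd_fun :> functor C C;
  cmd_e : forall x : C, mor (cmd_fun x) x;
  cmd_d : forall x : C, mor (cmd_fun x) (cmd_fun (cmd_fun x));
  cmd_e_nat : forall (x y : C) (f : mor x y),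
    cmd_e y \oc fmap cmd_fun f = f \oc cmd_e x;
  cmd_d_nat : forall (x y : C) (f : mor x y),
    cmd_d y \oc fmap cmd_fun f = fmap cmd_fun (fmap cmd_fun f) \oc cmd_d x;
  cmd_counitl : forall x : C, cmd_e (cmd_fun x) \oc cmd_d x = idmor (cmd_fun x);
  cmd_counitr : forall x : C,
    fmap cmd_fun (cmd_e x) \oc cmd_d x = idmor (cmd_fun x);
  cmd_coassoc : forall x : C,
    fmap cmd_fun (cmd_d x) \oc cmd_d x = cmd_d (cmd_fun x) \oc cmd_d x }.

Section EilenbergMoore.
Variables (C : category) (G : comonad C).

Record coalgebra := Coalgebra {
  coalg_ob :> C;
  coact : mor coalg_ob (G coalg_ob);
  coact_e : cmd_e G coalg_ob \oc coact = idmor coalg_ob;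
  coact_d : fmap G coact \oc coact = cmd_d G coalg_ob \oc coact }.

Definition coalg_pair (X : coalgebra) : {x : C & mor x (G x)} :=
  existT (fun x : C => mor x (G x)) (coalg_ob X) (coact X).

Record coalg_hom (X Y : coalgebra) := CoalgHom {
  coalg_mor :> mor (coalg_ob X) (coalg_ob Y);
  coalg_morP : fmap G coalg_mor \oc coact X = coact Y \oc coalg_mor }.

Lemma coalg_hom_eq X Y (f g : coalg_hom X Y) :
  coalg_mor f = coalg_mor g -> f = g.
Proof.
case: f g => [f pf] [g pg] /= e; subst g.
by rewrite (Prop_irrelevance pf pg).
Qed.

Lemma coalg_id_subproof (X : coalgebra) :
  fmap G (idmor (coalg_ob X)) \oc coact X = coact X \oc idmor (coalg_ob X).
Proof. by rewrite fmap1 mcomp1m mcompm1. Qed.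

Lemma coalg_comp_subproof (X Y Z : coalgebra)
    (g : coalg_hom Y Z) (f : coalg_hom X Y) :
  fmap G (coalg_mor g \oc coalg_mor f) \oc coact X
  = coact Z \oc (coalg_mor g \oc coalg_mor f).
Proof. by rewrite fmapM -mcompA coalg_morP mcompA coalg_morP -mcompA. Qed.

Definition EM_category : category.
Proof.
refine (@Category coalgebra coalg_hom
  (fun X => CoalgHom (coalg_id_subproof X))
  (fun X Y Z g f => CoalgHom (coalg_comp_subproof g f)) _ _ _).
- by move=> *; apply: coalg_hom_eq; apply: mcompA.
- by move=> *; apply: coalg_hom_eq; apply: mcomp1m.
- by move=> *; apply: coalg_hom_eq; apply: mcompm1.
Defined.

End EilenbergMoore.

(* The bicategory structures with given objects [O] and hom categories [H];
   [hcomp1 g f] is the composite of [f : a -> b] followed by [g : b -> c]. *)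
Record bicategory_on (O : Type) (H : O -> O -> category) := Bicategory {
  id1 : forall a, H a a;
  hcomp1 : forall a b c, H b c -> H a b -> H a c;
  hcomp2 : forall a b c (g g' : H b c) (f f' : H a b),
    mor g g' -> mor f f' -> mor (hcomp1 g f) (hcomp1 g' f');
  hcomp2_1 : forall a b c (g : H b c) (f : H a b),
    hcomp2 (idmor g) (idmor f) = idmor (hcomp1 g f);
  hcomp2_M : forall a b c (g g' g'' : H b c) (f f' f'' : H a b)
      (t' : mor g' g'') (t : mor g g') (s' : mor f' f'') (s : mor f f'),
    hcomp2 (t' \oc t) (s' \oc s) = hcomp2 t' s' \oc hcomp2 t s;
  assoc : forall a b c d (h : H c d) (g : H b c) (f : H a b),
    mor (hcomp1 (hcomp1 h g) f) (hcomp1 h (hcomp1 g f));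
  assocV : forall a b c d (h : H c d) (g : H b c) (f : H a b),
    mor (hcomp1 h (hcomp1 g f)) (hcomp1 (hcomp1 h g) f);
  assocK : forall a b c d (h : H c d) (g : H b c) (f : H a b),
    assocV h g f \oc assoc h g f = idmor _;
  assocVK : forall a b c d (h : H c d) (g : H b c) (f : H a b),
    assoc h g f \oc assocV h g f = idmor _;
  assoc_nat : forall a b c d (h h' : H c d) (g g' : H b c) (f f' : H a b)
      (u : mor h h') (t : mor g g') (s : mor f f'),
    assoc h' g' f' \oc hcomp2 (hcomp2 u t) s
    = hcomp2 u (hcomp2 t s) \oc assoc h g f;
  lunit : forall a b (f : H a b), mor (hcomp1 (id1 b) f) f;
  lunitV : forall a b (f : H a b), mor f (hcomp1 (id1 b) f);
  lunitK : forall a b (f : H a b), lunitV f \oc lunit f = idmor _;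
  lunitVK : forall a b (f : H a b), lunit f \oc lunitV f = idmor _;
  lunit_nat : forall a b (f f' : H a b) (s : mor f f'),
    lunit f' \oc hcomp2 (idmor (id1 b)) s = s \oc lunit f;
  runit : forall a b (f : H a b), mor (hcomp1 f (id1 a)) f;
  runitV : forall a b (f : H a b), mor f (hcomp1 f (id1 a));
  runitK : forall a b (f : H a b), runitV f \oc runit f = idmor _;
  runitVK : forall a b (f : H a b), runit f \oc runitV f = idmor _;
  runit_nat : forall a b (f f' : H a b) (s : mor f f'),
    runit f' \oc hcomp2 s (idmor (id1 a)) = s \oc runit f;
  pentagon : forall a b c d e (k : H d e) (h : H c d) (g : H b c) (f : H a b),
    assoc k h (hcomp1 g f) \oc assoc (hcomp1 k h) g f
    = hcomp2 (idmor k) (assoc h g f) \oc assoc k (hcomp1 h g) f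
        \oc hcomp2 (assoc k h g) (idmor f);
  triangle : forall a b c (g : H b c) (f : H a b),
    hcomp2 (idmor g) (lunit f) \oc assoc g (id1 b) f
    = hcomp2 (runit g) (idmor f) }.

(* Isomorphisms of bicategories that are the identity on objects: strict
   homomorphisms which are isomorphisms on all hom categories. *)
Record bicategory_iso (O : Type) (H K : O -> O -> category)
    (V : bicategory_on H) (W : bicategory_on K) := BicategoryIso {
  bi_fun :> forall a b, functor (H a b) (K a b);
  bi_ob_bij : forall a b, bijective (fob (bi_fun a b));
  bi_hom_bij : forall a b (x y : H a b),
    bijective (fun t : mor x y => fmap (bi_fun a b) t);
  bi_id1 : forall a, bi_fun a a (id1 V a) = id1 W a;
  bi_hcomp1 : forall a b c (g : H b c) (f : H a b),
    bi_fun a c (hcomp1 V g f) = hcomp1 W (bi_fun b c g) (bi_fun a b f);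
  bi_hcomp2 : forall a b c (g g' : H b c) (f f' : H a b)
      (t : mor g g') (s : mor f f'),
    arr (fmap (bi_fun a c) (hcomp2 V t s))
    = arr (hcomp2 W (fmap (bi_fun b c) t) (fmap (bi_fun a b) s));
  bi_assoc : forall a b c d (h : H c d) (g : H b c) (f : H a b),
    arr (fmap (bi_fun a d) (assoc V h g f))
    = arr (assoc W (bi_fun c d h) (bi_fun b c g) (bi_fun a b f));
  bi_lunit : forall a b (f : H a b),
    arr (fmap (bi_fun a b) (lunit V f)) = arr (lunit W (bi_fun a b f));
  bi_runit : forall a b (f : H a b),
    arr (fmap (bi_fun a b) (runit V f)) = arr (runit W (bi_fun a b f)) }.

Record caten_comonad (O : Type) (H : O -> O -> category)
    (V : bicategory_on H) := CatenComonad {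
  cc_ob : Type;
  cc_ob0 : cc_ob -> O;
  cc_cmd : forall a b : cc_ob, comonad (H (cc_ob0 a) (cc_ob0 b));
  cc_mu : forall (a b c : cc_ob)
      (g : H (cc_ob0 b) (cc_ob0 c)) (f : H (cc_ob0 a) (cc_ob0 b)),
    mor (hcomp1 V (cc_cmd b c g) (cc_cmd a b f)) (cc_cmd a c (hcomp1 V g f));
  cc_eta : forall a : cc_ob,
    mor (id1 V (cc_ob0 a)) (cc_cmd a a (id1 V (cc_ob0 a)));
  cc_mu_nat : forall (a b c : cc_ob)
      (g g' : H (cc_ob0 b) (cc_ob0 c)) (f f' : H (cc_ob0 a) (cc_ob0 b))
      (t : mor g g') (s : mor f f'),
    cc_mu g' f' \oc hcomp2 V (fmap (cc_cmd b c) t) (fmap (cc_cmd a b) s)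
    = fmap (cc_cmd a c) (hcomp2 V t s) \oc cc_mu g f;
  cc_mu_assoc : forall (a b c d : cc_ob) (h : H (cc_ob0 c) (cc_ob0 d))
      (g : H (cc_ob0 b) (cc_ob0 c)) (f : H (cc_ob0 a) (cc_ob0 b)),
    fmap (cc_cmd a d) (assoc V h g f)
      \oc cc_mu (hcomp1 V h g) f \oc hcomp2 V (cc_mu h g) (idmor (cc_cmd a b f))
    = cc_mu h (hcomp1 V g f) \oc hcomp2 V (idmor (cc_cmd c d h)) (cc_mu g f)
      \oc assoc V (cc_cmd c d h) (cc_cmd b c g) (cc_cmd a b f);
  cc_mu_lunit : forall (a b : cc_ob) (f : H (cc_ob0 a) (cc_ob0 b)),
    fmap (cc_cmd a b) (lunit V f)
      \oc cc_mu (id1 V (cc_ob0 b)) f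
      \oc hcomp2 V (cc_eta b) (idmor (cc_cmd a b f))
    = lunit V (cc_cmd a b f);
  cc_mu_runit : forall (a b : cc_ob) (f : H (cc_ob0 a) (cc_ob0 b)),
    fmap (cc_cmd a b) (runit V f)
      \oc cc_mu f (id1 V (cc_ob0 a))
      \oc hcomp2 V (idmor (cc_cmd a b f)) (cc_eta a)
    = runit V (cc_cmd a b f);
  cc_e_mu : forall (a b c : cc_ob)
      (g : H (cc_ob0 b) (cc_ob0 c)) (f : H (cc_ob0 a) (cc_ob0 b)),
    cmd_e (cc_cmd a c) (hcomp1 V g f) \oc cc_mu g f
    = hcomp2 V (cmd_e (cc_cmd b c) g) (cmd_e (cc_cmd a b) f);
  cc_e_eta : forall a : cc_ob,
    cmd_e (cc_cmd a a) (id1 V (cc_ob0 a)) \oc cc_eta a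
    = idmor (id1 V (cc_ob0 a));
  cc_d_mu : forall (a b c : cc_ob)
      (g : H (cc_ob0 b) (cc_ob0 c)) (f : H (cc_ob0 a) (cc_ob0 b)),
    cmd_d (cc_cmd a c) (hcomp1 V g f) \oc cc_mu g f
    = fmap (cc_cmd a c) (cc_mu g f)
      \oc cc_mu (cc_cmd b c g) (cc_cmd a b f)
      \oc hcomp2 V (cmd_d (cc_cmd b c) g) (cmd_d (cc_cmd a b) f);
  cc_d_eta : forall a : cc_ob,
    cmd_d (cc_cmd a a) (id1 V (cc_ob0 a)) \oc cc_eta a
    = fmap (cc_cmd a a) (cc_eta a) \oc cc_eta a }.

Arguments cc_ob0 {O H V} G a : rename.
Arguments cc_cmd {O H V} G a b : rename.
Arguments cc_mu {O H V} G {a b c} g f : rename.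
Arguments cc_eta {O H V} G a : rename.

Section EMBicategory.
Variables (O : Type) (H : O -> O -> category) (V : bicategory_on H).
Variable G : caten_comonad V.

Local Notation EM a b := (EM_category (cc_cmd G a b)).
Local Notation "g \ox f" := (hcomp1 V g f).
Local Notation "t \ox2 s" := (hcomp2 V t s).

Definition EM_coact a b c (Y : EM b c) (X : EM a b) :
    mor (coalg_ob Y \ox coalg_ob X)
        (cc_cmd G a c (coalg_ob Y \ox coalg_ob X)) :=
  cc_mu G (coalg_ob Y) (coalg_ob X) \oc (coact Y \ox2 coact X).

Lemma EM_coact_e a b c (Y : EM b c) (X : EM a b) :
  cmd_e (cc_cmd G a c) (coalg_ob Y \ox coalg_ob X) \oc EM_coact Y X = idmor _.
Proof.
by rewrite /EM_coact mcompA cc_e_mu -hcomp2_M !coact_e hcomp2_1.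
Qed.

Lemma EM_coact_d a b c (Y : EM b c) (X : EM a b) :
  fmap (cc_cmd G a c) (EM_coact Y X) \oc EM_coact Y X
  = cmd_d (cc_cmd G a c) (coalg_ob Y \ox coalg_ob X) \oc EM_coact Y X.
Proof.
rewrite /EM_coact fmapM mcompA -(mcompA (fmap _ (cc_mu _ _ _))) -cc_mu_nat.
by rewrite !mcompA cc_d_mu -!mcompA -!hcomp2_M !coact_d.
Qed.

Definition EM_hcomp1 a b c (Y : EM b c) (X : EM a b) : EM a c :=
  Coalgebra (EM_coact_e Y X) (EM_coact_d Y X).

Definition EM_id1 a : EM a a :=
  @Coalgebra _ (cc_cmd G a a) (id1 V (cc_ob0 G a)) (cc_eta G a)
    (cc_e_eta a) (esym (cc_d_eta a)).

Lemma EM_hcomp2_subproof a b c (Y Y' : EM b c) (X X' : EM a b)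
    (t : mor Y Y') (s : mor X X') :
  fmap (cc_cmd G a c) (coalg_mor t \ox2 coalg_mor s) \oc EM_coact Y X
  = EM_coact Y' X' \oc (coalg_mor t \ox2 coalg_mor s).
Proof.
by rewrite /EM_coact mcompA -cc_mu_nat -!mcompA -!hcomp2_M !coalg_morP.
Qed.

Definition EM_hcomp2 a b c (Y Y' : EM b c) (X X' : EM a b)
    (t : mor Y Y') (s : mor X X') : mor (EM_hcomp1 Y X) (EM_hcomp1 Y' X') :=
  @CoalgHom _ _ (EM_hcomp1 Y X) (EM_hcomp1 Y' X') _ (EM_hcomp2_subproof t s).

Lemma EM_inv_subproof a b (X Y : EM a b) (f : mor (coalg_ob X) (coalg_ob Y))
    (g : mor (coalg_ob Y) (coalg_ob X)) :
  g \oc f = idmor _ -> f \oc g = idmor _ ->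
  fmap (cc_cmd G a b) f \oc coact X = coact Y \oc f ->
  fmap (cc_cmd G a b) g \oc coact Y = coact X \oc g.
Proof.
move=> gf fg.
move=> /(congr1 (fun h => fmap (cc_cmd G a b) g \oc h \oc g)) /=.
by rewrite -!mcompA fg mcompm1 mcompA -fmapM gf fmap1 mcomp1m => ->.
Qed.

Lemma EM_assoc_subproof a b c d (Z : EM c d) (Y : EM b c) (X : EM a b) :
  fmap (cc_cmd G a d) (assoc V (coalg_ob Z) (coalg_ob Y) (coalg_ob X))
    \oc coact (EM_hcomp1 (EM_hcomp1 Z Y) X)
  = coact (EM_hcomp1 Z (EM_hcomp1 Y X))
    \oc assoc V (coalg_ob Z) (coalg_ob Y) (coalg_ob X).
Proof.
rewrite /= /EM_coact /= /EM_coact.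
rewrite -[coact X in LHS]mcomp1m hcomp2_M !mcompA cc_mu_assoc.
rewrite -mcompA assoc_nat !mcompA; congr (_ \oc _).
by rewrite -mcompA -hcomp2_M mcomp1m.
Qed.

Lemma EM_lunit_subproof a b (X : EM a b) :
  fmap (cc_cmd G a b) (lunit V (coalg_ob X)) \oc coact (EM_hcomp1 (EM_id1 b) X)
  = coact X \oc lunit V (coalg_ob X).
Proof.
rewrite /= /EM_coact /= -lunit_nat -cc_mu_lunit -!mcompA -hcomp2_M.
by rewrite mcompm1 mcomp1m.
Qed.

Lemma EM_runit_subproof a b (X : EM a b) :
  fmap (cc_cmd G a b) (runit V (coalg_ob X)) \oc coact (EM_hcomp1 X (EM_id1 a))
  = coact X \oc runit V (coalg_ob X).
Proof.
rewrite /= /EM_coact /= -runit_nat -cc_mu_runit -!mcompA -hcomp2_M.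
by rewrite mcompm1 mcomp1m.
Qed.

Definition EM_assoc a b c d (Z : EM c d) (Y : EM b c) (X : EM a b) :
    mor (EM_hcomp1 (EM_hcomp1 Z Y) X)
        (EM_hcomp1 Z (EM_hcomp1 Y X)) :=
  @CoalgHom _ _ (EM_hcomp1 (EM_hcomp1 Z Y) X) (EM_hcomp1 Z (EM_hcomp1 Y X))
    (assoc V (coalg_ob Z) (coalg_ob Y) (coalg_ob X)) (EM_assoc_subproof Z Y X).

Definition EM_assocV a b c d (Z : EM c d) (Y : EM b c) (X : EM a b) :
    mor (EM_hcomp1 Z (EM_hcomp1 Y X))
        (EM_hcomp1 (EM_hcomp1 Z Y) X) :=
  @CoalgHom _ _ (EM_hcomp1 Z (EM_hcomp1 Y X)) (EM_hcomp1 (EM_hcomp1 Z Y) X)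
    (assocV V (coalg_ob Z) (coalg_ob Y) (coalg_ob X))
    (@EM_inv_subproof a d (EM_hcomp1 (EM_hcomp1 Z Y) X)
       (EM_hcomp1 Z (EM_hcomp1 Y X)) _ _ (assocK V _ _ _) (assocVK V _ _ _)
       (EM_assoc_subproof Z Y X)).

Definition EM_lunit a b (X : EM a b) :
    mor (EM_hcomp1 (EM_id1 b) X)
        X :=
  @CoalgHom _ _ (EM_hcomp1 (EM_id1 b) X) X
    (lunit V (coalg_ob X)) (EM_lunit_subproof X).

Definition EM_lunitV a b (X : EM a b) :
    mor X
        (EM_hcomp1 (EM_id1 b) X) :=
  @CoalgHom _ _ X (EM_hcomp1 (EM_id1 b) X)
    (lunitV V (coalg_ob X))
    (@EM_inv_subproof a b (EM_hcomp1 (EM_id1 b) X) X _ _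
       (lunitK V _) (lunitVK V _)
       (EM_lunit_subproof X)).

Definition EM_runit a b (X : EM a b) :
    mor (EM_hcomp1 X (EM_id1 a))
        X :=
  @CoalgHom _ _ (EM_hcomp1 X (EM_id1 a)) X
    (runit V (coalg_ob X)) (EM_runit_subproof X).

Definition EM_runitV a b (X : EM a b) :
    mor X
        (EM_hcomp1 X (EM_id1 a)) :=
  @CoalgHom _ _ X (EM_hcomp1 X (EM_id1 a))
    (runitV V (coalg_ob X))
    (@EM_inv_subproof a b (EM_hcomp1 X (EM_id1 a)) X _ _
       (runitK V _) (runitVK V _)
       (EM_runit_subproof X)).

Definition EM_bicategory :
  bicategory_on (fun a b : cc_ob G => EM_category (cc_cmd G a b)).
Proof.
refine (@Bicategory _ (fun a b : cc_ob G => EM_category (cc_cmd G a b))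
  EM_id1 EM_hcomp1 EM_hcomp2 _ _ EM_assoc EM_assocV _ _ _
  EM_lunit EM_lunitV _ _ _ EM_runit EM_runitV _ _ _ _ _);
  move=> *; apply: coalg_hom_eq.
- exact: hcomp2_1.
- exact: hcomp2_M.
- exact: assocK.
- exact: assocVK.
- exact: assoc_nat.
- exact: lunitK.
- exact: lunitVK.
- exact: lunit_nat.
- exact: runitK.
- exact: runitVK.
- exact: runit_nat.
- exact: pentagon.
- exact: triangle.
Defined.

End EMBicategory.

(* The abelian group structures are MathComp [zmodType] structures; the choice
   operator these contain exists on every type by classical choice. *)
Record zmod_homs_category := ZmodHomsCategory {
  zh_cat :> category;
  zh_zmod : forall x y : zh_cat, GRing.Zmodule (mor x y) }.

HB.instance Definition _ (A : zmod_homs_category) (x y : A) := zh_zmod x y.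

Record preadditive := Preadditive {
  pre_zh :> zmod_homs_category;
  mcompDl : forall (x y z : pre_zh) (g g' : mor y z) (f : mor x y),
    (g + g') \oc f = g \oc f + g' \oc f;
  mcompDr : forall (x y z : pre_zh) (g : mor y z) (f f' : mor x y),
    g \oc (f + f') = g \oc f + g \oc f' }.

Record additive_functor (A B : preadditive) := AdditiveFunctor {
  afun :> functor A B;
  afunD : forall (x y : A) (f f' : mor x y),
    fmap afun (f + f') = fmap afun f + fmap afun f' }.

Record biproduct (A : preadditive) (x y : A) := Biproduct {
  bp_ob :> A;
  bp_p1 : mor bp_ob x;
  bp_p2 : mor bp_ob y;
  bp_i1 : mor x bp_ob;
  bp_i2 : mor y bp_ob;
  bp_p1i1 : bp_p1 \oc bp_i1 = idmor x;
  bp_p2i2 : bp_p2 \oc bp_i2 = idmor y;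
  bp_p1i2 : bp_p1 \oc bp_i2 = 0;
  bp_p2i1 : bp_p2 \oc bp_i1 = 0;
  bp_sum : bp_i1 \oc bp_p1 + bp_i2 \oc bp_p2 = idmor bp_ob }.

Record direct_sums (A : preadditive) := DirectSums {
  ds_zero : A;
  ds_zeroP : idmor ds_zero = 0;
  ds_biprod : forall x y : A, biproduct x y }.

Section AdditiveLemmas.
Variable A : preadditive.

Lemma mcomp0l (x y z : A) (f : mor x y) : (0 : mor y z) \oc f = 0.
Proof. by apply: (addrI ((0 : mor y z) \oc f)); rewrite -mcompDl !addr0. Qed.

Lemma mcomp0r (x y z : A) (g : mor y z) : g \oc (0 : mor x y) = 0.
Proof. by apply: (addrI (g \oc (0 : mor x y))); rewrite -mcompDr !addr0. Qed.

Lemma afun0 (B : preadditive) (F : additive_functor A B) (x y : A) :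
  fmap F (0 : mor x y) = 0.
Proof. by apply: (addrI (fmap F (0 : mor x y))); rewrite -afunD !addr0. Qed.

Lemma biproduct_ext (x y z : A) (s : biproduct x y) (f g : mor z s) :
  bp_p1 s \oc f = bp_p1 s \oc g -> bp_p2 s \oc f = bp_p2 s \oc g -> f = g.
Proof.
move=> e1 e2; rewrite -[f]mcomp1m -[g]mcomp1m -(bp_sum s) !mcompDl -!mcompA.
by rewrite e1 e2.
Qed.

Definition pair_mor (x y z : A) (s : biproduct x y)
    (f : mor z x) (g : mor z y) : mor z s :=
  bp_i1 s \oc f + bp_i2 s \oc g.

Lemma p1_pair (x y z : A) (s : biproduct x y) (f : mor z x) (g : mor z y) :
  bp_p1 s \oc pair_mor s f g = f.
Proof.
by rewrite /pair_mor mcompDr !mcompA bp_p1i1 bp_p1i2 mcomp1m mcomp0l addr0.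
Qed.

Lemma p2_pair (x y z : A) (s : biproduct x y) (f : mor z x) (g : mor z y) :
  bp_p2 s \oc pair_mor s f g = g.
Proof.
by rewrite /pair_mor mcompDr !mcompA bp_p2i1 bp_p2i2 mcomp1m mcomp0l add0r.
Qed.

Lemma pair_comp (x y z w : A) (s : biproduct x y) (f : mor z x) (g : mor z y)
    (h : mor w z) : pair_mor s f g \oc h = pair_mor s (f \oc h) (g \oc h).
Proof. by rewrite /pair_mor mcompDl !mcompA. Qed.

End AdditiveLemmas.

Section SquareZeroComonad.
Variables (A : preadditive) (S : direct_sums A) (D : additive_functor A A).

Definition sz_bp (x : A) : biproduct x (D x) := ds_biprod S x (D x).

Definition sz_map (x y : A) (f : mor x y) : mor (sz_bp x) (sz_bp y) :=
  pair_mor (sz_bp y) (f \oc bp_p1 (sz_bp x)) (fmap D f \oc bp_p2 (sz_bp x)).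

Lemma sz_map1 (x : A) : sz_map (idmor x) = idmor (bp_ob (sz_bp x)).
Proof. by rewrite /sz_map fmap1 !mcomp1m /pair_mor bp_sum. Qed.

Lemma sz_mapM (x y z : A) (g : mor y z) (f : mor x y) :
  sz_map (g \oc f) = sz_map g \oc sz_map f.
Proof.
by rewrite /sz_map pair_comp -!mcompA p1_pair p2_pair fmapM !mcompA.
Qed.

Definition sz_functor : functor A A :=
  @Functor A A (fun x => bp_ob (sz_bp x)) sz_map sz_map1 sz_mapM.

Definition sz_e (x : A) : mor (sz_functor x) x := bp_p1 (sz_bp x).

(* The four by two matrix with rows (1 0), (0 1), (0 1), (0 0), where the
   additivity of [D] identifies [D (x + D x)] with [D x + D (D x)]: the first
   two rows are the identity and the last two are [D] of the first injection
   precomposed with the second projection. *)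
Definition sz_d (x : A) : mor (sz_functor x) (sz_functor (sz_functor x)) :=
  pair_mor (sz_bp (sz_bp x)) (idmor (bp_ob (sz_bp x)))
    (fmap D (bp_i1 (sz_bp x)) \oc bp_p2 (sz_bp x)).

Lemma sz_p1_map (x y : A) (f : mor x y) :
  bp_p1 (sz_bp y) \oc sz_map f = f \oc bp_p1 (sz_bp x).
Proof. exact: p1_pair. Qed.

Lemma sz_p2_map (x y : A) (f : mor x y) :
  bp_p2 (sz_bp y) \oc sz_map f = fmap D f \oc bp_p2 (sz_bp x).
Proof. exact: p2_pair. Qed.

Lemma sz_p1_d (x : A) :
  bp_p1 (sz_bp (sz_bp x)) \oc sz_d x = idmor (bp_ob (sz_bp x)).
Proof. exact: p1_pair. Qed.

Lemma sz_p2_d (x : A) :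
  bp_p2 (sz_bp (sz_bp x)) \oc sz_d x
  = fmap D (bp_i1 (sz_bp x)) \oc bp_p2 (sz_bp x).
Proof. exact: p2_pair. Qed.

Lemma sz_map_i1 (x y : A) (f : mor x y) :
  sz_map f \oc bp_i1 (sz_bp x) = bp_i1 (sz_bp y) \oc f.
Proof.
rewrite /sz_map pair_comp -!mcompA bp_p1i1 bp_p2i1 mcompm1 mcomp0r.
by rewrite /pair_mor mcomp0r addr0.
Qed.

Lemma sz_d_i1 (x : A) :
  sz_d x \oc bp_i1 (sz_bp x) = bp_i1 (sz_bp (sz_bp x)) \oc bp_i1 (sz_bp x).
Proof.
rewrite /sz_d pair_comp mcomp1m -mcompA bp_p2i1 mcomp0r.
by rewrite /pair_mor mcomp0r addr0.
Qed.

Lemma sz_e_nat (x y : A) (f : mor x y) :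
  sz_e y \oc fmap sz_functor f = f \oc sz_e x.
Proof. exact: p1_pair. Qed.

Lemma sz_d_nat (x y : A) (f : mor x y) :
  sz_d y \oc fmap sz_functor f
  = fmap sz_functor (fmap sz_functor f) \oc sz_d x.
Proof.
apply: biproduct_ext; rewrite /= !mcompA.
  by rewrite sz_p1_d sz_p1_map -mcompA sz_p1_d mcomp1m mcompm1.
rewrite sz_p2_d sz_p2_map -!mcompA sz_p2_d sz_p2_map !mcompA -!fmapM.
by rewrite sz_map_i1.
Qed.

Lemma sz_counitl (x : A) :
  sz_e (sz_functor x) \oc sz_d x = idmor (sz_functor x).
Proof. exact: p1_pair. Qed.

Lemma sz_counitr (x : A) :
  fmap sz_functor (sz_e x) \oc sz_d x = idmor (sz_functor x).
Proof.
apply: biproduct_ext; rewrite /= !mcompA.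
  by rewrite sz_p1_map -mcompA sz_p1_d !mcompm1.
rewrite sz_p2_map -mcompA sz_p2_d mcompA -fmapM bp_p1i1 fmap1.
by rewrite mcomp1m mcompm1.
Qed.

Lemma sz_coassoc (x : A) :
  fmap sz_functor (sz_d x) \oc sz_d x = sz_d (sz_functor x) \oc sz_d x.
Proof.
apply: biproduct_ext; rewrite /= !mcompA.
  by rewrite sz_p1_map sz_p1_d -mcompA sz_p1_d mcomp1m mcompm1.
rewrite sz_p2_map sz_p2_d -!mcompA !sz_p2_d !mcompA -!fmapM.
by rewrite sz_d_i1.
Qed.

Definition sz_comonad : comonad A :=
  Comonad sz_e_nat sz_d_nat sz_counitl sz_counitr sz_coassoc.

End SquareZeroComonad.

(* Finite direct sums in the hom categories are kept apart, in
   [local_direct_sums]. *)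
Record locally_additive_bicategory := LocallyAdditiveBicategory {
  la_ob :> Type;
  la_hom : la_ob -> la_ob -> preadditive;
  la_bicat : bicategory_on la_hom;
  la_hcompDl : forall a b c (g g' : la_hom b c) (t t' : mor g g')
      (f : la_hom a b),
    hcomp2 la_bicat (t + t') (idmor f)
    = hcomp2 la_bicat t (idmor f) + hcomp2 la_bicat t' (idmor f);
  la_hcompDr : forall a b c (g : la_hom b c) (f f' : la_hom a b)
      (s s' : mor f f'),
    hcomp2 la_bicat (idmor g) (s + s')
    = hcomp2 la_bicat (idmor g) s + hcomp2 la_bicat (idmor g) s' }.

Notation "g \ox f" := (hcomp1 (la_bicat _) g f).
Notation "t \ox2 s" := (hcomp2 (la_bicat _) t s).

Definition local_direct_sums (V : locally_additive_bicategory) :=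
  forall a b : V, direct_sums (la_hom a b).

(* The associativity and unit constraints of [V], usually suppressed in these
   axioms, are written out. *)
Record differential_system (V : locally_additive_bicategory) :=
    DifferentialSystem {
  dsys_ob : Type;
  dsys_ob0 : dsys_ob -> V;
  dsys_D : forall a b : dsys_ob,
    additive_functor (la_hom (dsys_ob0 a) (dsys_ob0 b))
                     (la_hom (dsys_ob0 a) (dsys_ob0 b));
  dsys_r : forall (a b c : dsys_ob) (g : la_hom (dsys_ob0 b) (dsys_ob0 c))
      (f : la_hom (dsys_ob0 a) (dsys_ob0 b)),
    mor (dsys_D b c g \ox f) (dsys_D a c (g \ox f));
  dsys_l : forall (a b c : dsys_ob) (g : la_hom (dsys_ob0 b) (dsys_ob0 c))
      (f : la_hom (dsys_ob0 a) (dsys_ob0 b)),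
    mor (g \ox dsys_D a b f) (dsys_D a c (g \ox f));
  dsys_r_nat : forall (a b c : dsys_ob)
      (g g' : la_hom (dsys_ob0 b) (dsys_ob0 c))
      (f f' : la_hom (dsys_ob0 a) (dsys_ob0 b)) (t : mor g g') (s : mor f f'),
    dsys_r g' f' \oc (fmap (dsys_D b c) t \ox2 s)
    = fmap (dsys_D a c) (t \ox2 s) \oc dsys_r g f;
  dsys_l_nat : forall (a b c : dsys_ob)
      (g g' : la_hom (dsys_ob0 b) (dsys_ob0 c))
      (f f' : la_hom (dsys_ob0 a) (dsys_ob0 b)) (t : mor g g') (s : mor f f'),
    dsys_l g' f' \oc (t \ox2 fmap (dsys_D a b) s)
    = fmap (dsys_D a c) (t \ox2 s) \oc dsys_l g f;
  dsys_rr : forall (a b c d : dsys_ob)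
      (h : la_hom (dsys_ob0 c) (dsys_ob0 d))
      (g : la_hom (dsys_ob0 b) (dsys_ob0 c))
      (f : la_hom (dsys_ob0 a) (dsys_ob0 b)),
    fmap (dsys_D a d) (assoc (la_bicat V) h g f)
      \oc dsys_r (h \ox g) f \oc (dsys_r h g \ox2 idmor f)
    = dsys_r h (g \ox f) \oc assoc (la_bicat V) (dsys_D c d h) g f;
  dsys_ll : forall (a b c d : dsys_ob)
      (h : la_hom (dsys_ob0 c) (dsys_ob0 d))
      (g : la_hom (dsys_ob0 b) (dsys_ob0 c))
      (f : la_hom (dsys_ob0 a) (dsys_ob0 b)),
    dsys_l h (g \ox f) \oc (idmor h \ox2 dsys_l g f)
      \oc assoc (la_bicat V) h g (dsys_D a b f)
    = fmap (dsys_D a d) (assoc (la_bicat V) h g f)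
      \oc dsys_l (h \ox g) f;
  dsys_rl : forall (a b c d : dsys_ob)
      (h : la_hom (dsys_ob0 c) (dsys_ob0 d))
      (g : la_hom (dsys_ob0 b) (dsys_ob0 c))
      (f : la_hom (dsys_ob0 a) (dsys_ob0 b)),
    fmap (dsys_D a d) (assoc (la_bicat V) h g f)
      \oc dsys_r (h \ox g) f \oc (dsys_l h g \ox2 idmor f)
    = dsys_l h (g \ox f) \oc (idmor h \ox2 dsys_r g f)
      \oc assoc (la_bicat V) h (dsys_D b c g) f;
  dsys_r1 : forall (a b : dsys_ob) (f : la_hom (dsys_ob0 a) (dsys_ob0 b)),
    fmap (dsys_D a b) (runit (la_bicat V) f)
      \oc dsys_r f (id1 (la_bicat V) (dsys_ob0 a))
    = runit (la_bicat V) (dsys_D a b f);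
  dsys_l1 : forall (a b : dsys_ob) (f : la_hom (dsys_ob0 a) (dsys_ob0 b)),
    fmap (dsys_D a b) (lunit (la_bicat V) f)
      \oc dsys_l (id1 (la_bicat V) (dsys_ob0 b)) f
    = lunit (la_bicat V) (dsys_D a b f);
  dsys_dd : forall (a b c : dsys_ob) (g : la_hom (dsys_ob0 b) (dsys_ob0 c))
      (f : la_hom (dsys_ob0 a) (dsys_ob0 b)),
    fmap (dsys_D a c) (dsys_l g f) \oc dsys_r g (dsys_D a b f)
    + fmap (dsys_D a c) (dsys_r g f) \oc dsys_l (dsys_D b c g) f
    = 0 }.

Arguments dsys_ob0 {V} _ a : rename.
Arguments dsys_D {V} _ a b : rename.
Arguments dsys_r {V} _ {a b c} g f : rename.
Arguments dsys_l {V} _ {a b c} g f : rename.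

Section DifferentialComonad.
Variables (V : locally_additive_bicategory) (S : local_direct_sums V).
Variable D : differential_system V.

Local Notation B := (la_bicat V).
Local Notation hm a b := (la_hom (dsys_ob0 D a) (dsys_ob0 D b)).
Local Notation G a b :=
  (sz_comonad (S (dsys_ob0 D a) (dsys_ob0 D b)) (dsys_D D a b)).
Local Notation bp a b :=
  (sz_bp (S (dsys_ob0 D a) (dsys_ob0 D b)) (dsys_D D a b)).

Lemma hcomp2_r a b c (g g' g'' : hm b c) (f f' : hm a b)
    (t' : mor g' g'') (t : mor g g') (s : mor f f') :
  (t' \oc t) \ox2 s = (t' \ox2 idmor f') \oc (t \ox2 s).
Proof. by rewrite -hcomp2_M mcomp1m. Qed.

Lemma hcomp2_l a b c (g g' : hm b c) (f f' f'' : hm a b)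
    (t : mor g g') (s' : mor f' f'') (s : mor f f') :
  t \ox2 (s' \oc s) = (idmor g' \ox2 s') \oc (t \ox2 s).
Proof. by rewrite -hcomp2_M mcomp1m. Qed.

Lemma hcomp2_Dl a b c (g g' : hm b c) (f f' : hm a b)
    (t t' : mor g g') (s : mor f f') :
  (t + t') \ox2 s = t \ox2 s + t' \ox2 s.
Proof.
have E (u : mor g g') : u \ox2 s = (u \ox2 idmor f') \oc (idmor g \ox2 s).
  by rewrite -hcomp2_M mcomp1m mcompm1.
by rewrite !E la_hcompDl mcompDl.
Qed.

Lemma hcomp2_Dr a b c (g g' : hm b c) (f f' : hm a b)
    (t : mor g g') (s s' : mor f f') :
  t \ox2 (s + s') = t \ox2 s + t \ox2 s'.
Proof.
have E (u : mor f f') : t \ox2 u = (idmor g' \ox2 u) \oc (t \ox2 idmor f).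
  by rewrite -hcomp2_M mcomp1m mcompm1.
by rewrite !E la_hcompDr mcompDl.
Qed.

Lemma hcomp2_0l a b c (g g' : hm b c) (f f' : hm a b) (s : mor f f') :
  (0 : mor g g') \ox2 s = 0.
Proof.
by apply: (addrI ((0 : mor g g') \ox2 s)); rewrite -hcomp2_Dl !addr0.
Qed.

Lemma hcomp2_0r a b c (g g' : hm b c) (f f' : hm a b) (t : mor g g') :
  t \ox2 (0 : mor f f') = 0.
Proof.
by apply: (addrI (t \ox2 (0 : mor f f'))); rewrite -hcomp2_Dr !addr0.
Qed.

(* The matrix with rows (1 0 0 0) and (0 l r 0) on the four summands
   g f, g D(f), D(g) f, D(g) D(f) of (g + D g) (f + D f). *)
Definition dc_mu a b c (g : hm b c) (f : hm a b) :
    mor (G b c g \ox G a b f) (G a c (g \ox f)) :=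
  pair_mor (bp a c (g \ox f))
    (bp_p1 (bp b c g) \ox2 bp_p1 (bp a b f))
    (dsys_l D g f \oc (bp_p1 (bp b c g) \ox2 bp_p2 (bp a b f))
     + dsys_r D g f \oc (bp_p2 (bp b c g) \ox2 bp_p1 (bp a b f))).

Definition dc_eta a :
    mor (id1 B (dsys_ob0 D a)) (G a a (id1 B (dsys_ob0 D a))) :=
  bp_i1 (bp a a (id1 B (dsys_ob0 D a))).

Lemma dc_p1_mu a b c (g : hm b c) (f : hm a b) :
  bp_p1 (bp a c (g \ox f)) \oc dc_mu g f
  = bp_p1 (bp b c g) \ox2 bp_p1 (bp a b f).
Proof. exact: p1_pair. Qed.

Lemma dc_p2_mu a b c (g : hm b c) (f : hm a b) :
  bp_p2 (bp a c (g \ox f)) \oc dc_mu g f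
  = dsys_l D g f \oc (bp_p1 (bp b c g) \ox2 bp_p2 (bp a b f))
    + dsys_r D g f \oc (bp_p2 (bp b c g) \ox2 bp_p1 (bp a b f)).
Proof. exact: p2_pair. Qed.

Lemma dc_p1_d a b (f : hm a b) :
  bp_p1 (bp a b (bp a b f)) \oc cmd_d (G a b) f = idmor (bp_ob (bp a b f)).
Proof. exact: sz_p1_d. Qed.

Lemma dc_p2_d a b (f : hm a b) :
  bp_p2 (bp a b (bp a b f)) \oc cmd_d (G a b) f
  = fmap (dsys_D D a b) (bp_i1 (bp a b f)) \oc bp_p2 (bp a b f).
Proof. exact: sz_p2_d. Qed.

Lemma dc_p1_map a b (f f' : hm a b) (s : mor f f') :
  bp_p1 (bp a b f') \oc fmap (G a b) s = s \oc bp_p1 (bp a b f).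
Proof. exact: sz_p1_map. Qed.

Lemma dc_p2_map a b (f f' : hm a b) (s : mor f f') :
  bp_p2 (bp a b f') \oc fmap (G a b) s
  = fmap (dsys_D D a b) s \oc bp_p2 (bp a b f).
Proof. exact: sz_p2_map. Qed.

Lemma dc_mu_nat a b c (g g' : hm b c) (f f' : hm a b)
    (t : mor g g') (s : mor f f') :
  dc_mu g' f' \oc (fmap (G b c) t \ox2 fmap (G a b) s)
  = fmap (G a c) (t \ox2 s) \oc dc_mu g f.
Proof.
apply: biproduct_ext; rewrite !mcompA.
  by rewrite dc_p1_mu dc_p1_map -mcompA dc_p1_mu -!hcomp2_M !dc_p1_map.
rewrite dc_p2_mu dc_p2_map -mcompA dc_p2_mu mcompDl mcompDr -!mcompA -!hcomp2_M.
rewrite !dc_p1_map !dc_p2_map !hcomp2_M; congr (_ + _); rewrite !mcompA.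
  by rewrite dsys_l_nat.
by rewrite dsys_r_nat.
Qed.

Lemma dc_mu_assoc a b c d (h : hm c d) (g : hm b c) (f : hm a b) :
  fmap (G a d) (assoc B h g f) \oc dc_mu (h \ox g) f
    \oc (dc_mu h g \ox2 idmor (G a b f))
  = dc_mu h (g \ox f) \oc (idmor (G c d h) \ox2 dc_mu g f)
    \oc assoc B (G c d h) (G b c g) (G a b f).
Proof.
apply: biproduct_ext; rewrite !mcompA.
  rewrite dc_p1_map dc_p1_mu -!mcompA.
  rewrite (mcompA (bp_p1 _)) dc_p1_mu -!hcomp2_M dc_p1_mu mcompm1.
  by rewrite assoc_nat (mcompA (_ \ox2 _)) -hcomp2_M dc_p1_mu mcompm1.
rewrite dc_p2_map dc_p2_mu -!mcompA (mcompA (bp_p2 _)) dc_p2_mu.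
rewrite !mcompDl !mcompDr -!mcompA -!hcomp2_M dc_p1_mu dc_p2_mu !mcompm1.
rewrite (mcompA (_ \ox2 _)) -hcomp2_M dc_p2_mu mcompm1.
rewrite (mcompA (_ \ox2 _)) -hcomp2_M dc_p1_mu mcompm1.
rewrite hcomp2_Dr hcomp2_Dl !mcompDr !mcompDl !mcompDr -addrA.
congr (_ + (_ + _)).
- rewrite hcomp2_l -!mcompA -assoc_nat !mcompA.
  by rewrite dsys_ll.
- rewrite hcomp2_r hcomp2_l -!mcompA -assoc_nat !mcompA.
  by rewrite dsys_rl.
- rewrite hcomp2_r -assoc_nat !mcompA.
  by rewrite dsys_rr.
Qed.

Lemma dc_mu_lunit a b (f : hm a b) :
  fmap (G a b) (lunit B f) \oc dc_mu (id1 B (dsys_ob0 D b)) f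
    \oc (dc_eta b \ox2 idmor (G a b f))
  = lunit B (G a b f).
Proof.
apply: biproduct_ext; rewrite !mcompA.
  rewrite dc_p1_map -!mcompA (mcompA (bp_p1 _)) dc_p1_mu -hcomp2_M.
  by rewrite bp_p1i1 mcompm1 lunit_nat.
rewrite dc_p2_map -!mcompA (mcompA (bp_p2 _)) dc_p2_mu mcompDl -!mcompA.
rewrite -!hcomp2_M bp_p1i1 bp_p2i1 hcomp2_0l mcomp0r addr0 !mcompm1.
by rewrite mcompA dsys_l1 lunit_nat.
Qed.

Lemma dc_mu_runit a b (f : hm a b) :
  fmap (G a b) (runit B f) \oc dc_mu f (id1 B (dsys_ob0 D a))
    \oc (idmor (G a b f) \ox2 dc_eta a)
  = runit B (G a b f).
Proof.
apply: biproduct_ext; rewrite !mcompA.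
  rewrite dc_p1_map -!mcompA (mcompA (bp_p1 _)) dc_p1_mu -hcomp2_M.
  by rewrite bp_p1i1 mcompm1 runit_nat.
rewrite dc_p2_map -!mcompA (mcompA (bp_p2 _)) dc_p2_mu mcompDl -!mcompA.
rewrite -!hcomp2_M bp_p1i1 bp_p2i1 hcomp2_0r mcomp0r add0r !mcompm1.
by rewrite mcompA dsys_r1 runit_nat.
Qed.

Lemma dc_e_mu a b c (g : hm b c) (f : hm a b) :
  cmd_e (G a c) (g \ox f) \oc dc_mu g f
  = cmd_e (G b c) g \ox2 cmd_e (G a b) f.
Proof. exact: dc_p1_mu. Qed.

Lemma dc_e_eta a :
  cmd_e (G a a) (id1 B (dsys_ob0 D a)) \oc dc_eta a
  = idmor (id1 B (dsys_ob0 D a)).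
Proof. exact: bp_p1i1. Qed.

Lemma dc_mu_i1r a b c (g : hm b c) (f : hm a b) :
  dc_mu g f \oc (idmor (G b c g) \ox2 bp_i1 (bp a b f))
  = pair_mor (bp a c (g \ox f)) (bp_p1 (bp b c g) \ox2 idmor f)
      (dsys_r D g f \oc (bp_p2 (bp b c g) \ox2 idmor f)).
Proof.
rewrite /dc_mu pair_comp mcompDl -!mcompA -!hcomp2_M bp_p1i1 bp_p2i1 !mcompm1.
by rewrite hcomp2_0r mcomp0r add0r.
Qed.

Lemma dc_mu_i1l a b c (g : hm b c) (f : hm a b) :
  dc_mu g f \oc (bp_i1 (bp b c g) \ox2 idmor (G a b f))
  = pair_mor (bp a c (g \ox f)) (idmor g \ox2 bp_p1 (bp a b f))
      (dsys_l D g f \oc (idmor g \ox2 bp_p2 (bp a b f))).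
Proof.
rewrite /dc_mu pair_comp mcompDl -!mcompA -!hcomp2_M bp_p1i1 bp_p2i1 !mcompm1.
by rewrite hcomp2_0l mcomp0r addr0.
Qed.

Lemma dc_d_mu a b c (g : hm b c) (f : hm a b) :
  cmd_d (G a c) (g \ox f) \oc dc_mu g f
  = fmap (G a c) (dc_mu g f) \oc dc_mu (G b c g) (G a b f)
      \oc (cmd_d (G b c) g \ox2 cmd_d (G a b) f).
Proof.
apply: biproduct_ext; rewrite !mcompA.
  rewrite dc_p1_d mcomp1m dc_p1_map -!mcompA (mcompA (bp_p1 _)) dc_p1_mu.
  by rewrite -hcomp2_M !dc_p1_d hcomp2_1 mcompm1.
rewrite dc_p2_d dc_p2_map -!mcompA dc_p2_mu (mcompA (bp_p2 _)) dc_p2_mu.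
rewrite !mcompDl -!mcompA -!hcomp2_M !dc_p1_d !dc_p2_d.
have L : fmap (dsys_D D a c) (dc_mu g f) \oc
    (dsys_l D (G b c g) (G a b f) \oc
      (idmor (G b c g) \ox2
        (fmap (dsys_D D a b) (bp_i1 (bp a b f)) \oc bp_p2 (bp a b f))))
  = fmap (dsys_D D a c) (bp_i1 (bp a c (g \ox f))) \oc
      (dsys_l D g f \oc (bp_p1 (bp b c g) \ox2 bp_p2 (bp a b f)))
    + fmap (dsys_D D a c) (bp_i2 (bp a c (g \ox f))) \oc
      (fmap (dsys_D D a c) (dsys_r D g f) \oc dsys_l D (dsys_D D b c g) f)
      \oc (bp_p2 (bp b c g) \ox2 bp_p2 (bp a b f)).
  rewrite hcomp2_l (mcompA (dsys_l _ _ _)) dsys_l_nat !mcompA -fmapM dc_mu_i1r.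
  rewrite afunD !fmapM !mcompDl -!mcompA; congr (_ + _); congr (_ \oc _).
    by rewrite mcompA -dsys_l_nat fmap1 -mcompA -hcomp2_M mcompm1 mcomp1m.
  congr (_ \oc _).
  by rewrite mcompA -dsys_l_nat fmap1 -mcompA -hcomp2_M mcompm1 mcomp1m.
have R : fmap (dsys_D D a c) (dc_mu g f) \oc
    (dsys_r D (G b c g) (G a b f) \oc
      ((fmap (dsys_D D b c) (bp_i1 (bp b c g)) \oc bp_p2 (bp b c g))
         \ox2 idmor (G a b f)))
  = fmap (dsys_D D a c) (bp_i1 (bp a c (g \ox f))) \oc
      (dsys_r D g f \oc (bp_p2 (bp b c g) \ox2 bp_p1 (bp a b f)))
    + fmap (dsys_D D a c) (bp_i2 (bp a c (g \ox f))) \oc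
      (fmap (dsys_D D a c) (dsys_l D g f) \oc dsys_r D g (dsys_D D a b f))
      \oc (bp_p2 (bp b c g) \ox2 bp_p2 (bp a b f)).
  rewrite hcomp2_r (mcompA (dsys_r _ _ _)) dsys_r_nat !mcompA -fmapM dc_mu_i1l.
  rewrite afunD !fmapM !mcompDl -!mcompA; congr (_ + _); congr (_ \oc _).
    by rewrite mcompA -dsys_r_nat fmap1 -mcompA -hcomp2_M mcompm1 mcomp1m.
  congr (_ \oc _).
  by rewrite mcompA -dsys_r_nat fmap1 -mcompA -hcomp2_M mcompm1 mcomp1m.
rewrite [RHS]mcompDr L R addrACA -mcompDr -mcompDl -mcompDr.
by rewrite [X in _ \oc X \oc _]addrC dsys_dd mcomp0r mcomp0l addr0.
Qed.

Lemma dc_d_eta a :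
  cmd_d (G a a) (id1 B (dsys_ob0 D a)) \oc dc_eta a
  = fmap (G a a) (dc_eta a) \oc dc_eta a.
Proof. by rewrite [LHS]sz_d_i1 [RHS]sz_map_i1. Qed.

Definition differential_comonad : caten_comonad B :=
  @CatenComonad _ _ B (dsys_ob D) (dsys_ob0 D) (fun a b => G a b)
    dc_mu dc_eta dc_mu_nat dc_mu_assoc dc_mu_lunit dc_mu_runit
    dc_e_mu dc_e_eta dc_d_mu dc_d_eta.

End DifferentialComonad.

Section DifferentialHom.
Variables (V : locally_additive_bicategory) (D : differential_system V).
Variables a b : dsys_ob D.

Record diff_ob := DiffOb {
  dob_ob :> la_hom (dsys_ob0 D a) (dsys_ob0 D b);
  dob_d : mor dob_ob (dsys_D D a b dob_ob);
  dob_dd : fmap (dsys_D D a b) dob_d \oc dob_d = 0 }.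

Definition diff_pair (X : diff_ob) :
    {x : la_hom (dsys_ob0 D a) (dsys_ob0 D b) & mor x (dsys_D D a b x)} :=
  existT (fun x => mor x (dsys_D D a b x)) (dob_ob X) (dob_d X).

Record diff_hom (X Y : diff_ob) := DiffHom {
  dhom_mor :> mor (dob_ob X) (dob_ob Y);
  dhom_morP :
    fmap (dsys_D D a b) dhom_mor \oc dob_d X = dob_d Y \oc dhom_mor }.

Lemma diff_hom_eq X Y (f g : diff_hom X Y) :
  dhom_mor f = dhom_mor g -> f = g.
Proof.
case: f g => [f pf] [g pg] /= e; subst g.
by rewrite (Prop_irrelevance pf pg).
Qed.

Lemma diff_id_subproof (X : diff_ob) :
  fmap (dsys_D D a b) (idmor (dob_ob X)) \oc dob_d X
  = dob_d X \oc idmor (dob_ob X).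
Proof. by rewrite fmap1 mcomp1m mcompm1. Qed.

Lemma diff_comp_subproof (X Y Z : diff_ob)
    (g : diff_hom Y Z) (f : diff_hom X Y) :
  fmap (dsys_D D a b) (dhom_mor g \oc dhom_mor f) \oc dob_d X
  = dob_d Z \oc (dhom_mor g \oc dhom_mor f).
Proof. by rewrite fmapM -mcompA dhom_morP mcompA dhom_morP -mcompA. Qed.

Definition diff_category : category.
Proof.
refine (@Category diff_ob diff_hom
  (fun X => DiffHom (diff_id_subproof X))
  (fun X Y Z g f => DiffHom (diff_comp_subproof g f)) _ _ _).
- by move=> *; apply: diff_hom_eq; apply: mcompA.
- by move=> *; apply: diff_hom_eq; apply: mcomp1m.
- by move=> *; apply: diff_hom_eq; apply: mcompm1.
Defined.

End DifferentialHom.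

Arguments diff_category {V} D a b.

(* Main.v *)
(** For the square-zero comonad [x + D x], the counit law forces a coaction to
    have the form [(1, delta)], coassociativity then says [D delta o delta = 0],
    and being a morphism of coalgebras is the second component of the coaction
    square.  This identifies the hom categories, and the second component of
    [mu o ((1, delta') (x) (1, delta))] is the stated composite differential.
    Hence every law of the bicategory of differential pairs is read off from the
    one for coalgebras. *)

Require Import Defs.
From mathcomp Require Import all_boot all_algebra.
From mathcomp Require Import boolp.

Set Implicit Arguments.
Unset Strict Implicit.
Unset Printing Implicit Defensive.

Import GRing.Theory.
Local Open Scope ring_scope.

(** * Equality of coalgebras and of their packed morphisms *)

Section CoalgebraEquality.
Variables (C : category) (G : comonad C).

Lemma coalgebra_eq x (c c' : mor x (G x)) ce cd ce' cd' :
  c = c' -> @Coalgebra C G x c ce cd = @Coalgebra C G x c' ce' cd'.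
Proof.
move=> e; subst c'.
by rewrite (Prop_irrelevance ce ce') (Prop_irrelevance cd cd').
Qed.

(** Coactions that are equal without being convertible give endpoints of different form, hence the
    packing by [arr]. Once the coactions are identified, only proofs of laws differ. *)
Lemma arr_coalg_hom_eq x y (c c' : mor x (G x)) (k k' : mor y (G y))
    ce cd ce' cd' ke kd ke' kd'
    (X := @Coalgebra C G x c ce cd) (X' := @Coalgebra C G x c' ce' cd')
    (Y := @Coalgebra C G y k ke kd) (Y' := @Coalgebra C G y k' ke' kd')
    (t : mor x y) tP tP' :
  c = c' -> k = k' ->
  @arr (EM_category G) X Y (@CoalgHom C G X Y t tP)
  = @arr (EM_category G) X' Y' (@CoalgHom C G X' Y' t tP').
Proof.
move=> ec ek; subst c' k'.
(* The abbreviations are unfolded to expose the proofs of the coalgebra laws, which also occur in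
   the type of [tP']. *)
rewrite /X' /Y' /X /Y in tP tP' *.
rewrite -(Prop_irrelevance ce ce') -(Prop_irrelevance cd cd') in tP' *.
rewrite -(Prop_irrelevance ke ke') -(Prop_irrelevance kd kd') in tP' *.
by rewrite (Prop_irrelevance tP tP').
Qed.

End CoalgebraEquality.

(** * Coalgebras of the square-zero comonad as differentials *)

Section SquareZeroCoalgebra.
Variables (A : preadditive) (S : direct_sums A) (D : additive_functor A A).

Local Notation bp := (sz_bp S D).

Definition sz_coact (x : A) (d : mor x (D x)) : mor x (bp x) :=
  pair_mor (bp x) (idmor x) d.

Lemma sz_coact_e (x : A) (d : mor x (D x)) :
  bp_p1 (bp x) \oc sz_coact d = idmor x.
Proof. exact: p1_pair. Qed.

Lemma sz_coact_p2 (x : A) (c : mor x (bp x)) :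
  bp_p1 (bp x) \oc c = idmor x -> sz_coact (bp_p2 (bp x) \oc c) = c.
Proof.
by move=> ce; apply: biproduct_ext; rewrite ?p1_pair ?p2_pair // -ce.
Qed.

(** The first components agree for every [d]; the second ones differ by the term [D i2 o (D d o d)],
    which only the left side contains. *)
Lemma sz_coact_dP (x : A) (d : mor x (D x)) :
  sz_map S D (sz_coact d) \oc sz_coact d = sz_d S D x \oc sz_coact d
  <-> fmap D d \oc d = 0.
Proof.
have p2l : bp_p2 (bp (bp x)) \oc (sz_map S D (sz_coact d) \oc sz_coact d)
    = fmap D (bp_i1 (bp x)) \oc d
      + fmap D (bp_i2 (bp x)) \oc (fmap D d \oc d).
  rewrite mcompA sz_p2_map -mcompA p2_pair /sz_coact /pair_mor.
  by rewrite afunD mcompm1 fmapM mcompDl mcompA.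
have p2r : bp_p2 (bp (bp x)) \oc (sz_d S D x \oc sz_coact d)
    = fmap D (bp_i1 (bp x)) \oc d.
  by rewrite mcompA sz_p2_d -mcompA p2_pair.
split=> [e|dd]; last first.
  apply: biproduct_ext; last by rewrite p2l p2r dd mcomp0r addr0.
  rewrite !mcompA sz_p1_map sz_p1_d.
  by rewrite -mcompA p1_pair mcomp1m mcompm1.
have z : fmap D (bp_i2 (bp x)) \oc (fmap D d \oc d) = 0.
  by apply: (addrI (fmap D (bp_i1 (bp x)) \oc d)); rewrite -p2l e p2r addr0.
(* [D i2] is a split monomorphism with retraction [D p2], so it can be cancelled from [z]. *)
rewrite -[LHS]mcomp1m -fmap1 -(bp_p2i2 (bp x)) fmapM -mcompA z.
exact: mcomp0r.
Qed.

(** Both first components are [t], so only the second ones carry a condition. *)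
Lemma sz_coact_homP (x y : A) (d : mor x (D x)) (k : mor y (D y))
    (t : mor x y) :
  sz_map S D t \oc sz_coact d = sz_coact k \oc t <-> fmap D t \oc d = k \oc t.
Proof.
have p2l : bp_p2 (bp y) \oc (sz_map S D t \oc sz_coact d) = fmap D t \oc d.
  by rewrite mcompA sz_p2_map -mcompA p2_pair.
have p2r : bp_p2 (bp y) \oc (sz_coact k \oc t) = k \oc t.
  by rewrite mcompA p2_pair.
split=> [e|e]; first by rewrite -p2l e p2r.
apply: biproduct_ext; last by rewrite p2l p2r.
rewrite !mcompA sz_p1_map -mcompA !p1_pair.
by rewrite mcompm1 mcomp1m.
Qed.

End SquareZeroCoalgebra.

(** * Isomorphism of the hom categories of differential pairs and of coalgebras *)

Section DifferentialBicategory.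
Variables (V : locally_additive_bicategory) (S : local_direct_sums V).
Variable D : differential_system V.

Local Notation B := (la_bicat V).
Local Notation hm a b := (la_hom (dsys_ob0 D a) (dsys_ob0 D b)).
Local Notation Dc a b := (diff_category D a b).
Local Notation DG := (differential_comonad S D).
Local Notation EM a b := (EM_category (cc_cmd DG a b)).
Local Notation coact_of a b d :=
  (@sz_coact _ (S (dsys_ob0 D a) (dsys_ob0 D b)) (dsys_D D a b) _ d).

Lemma diff_ob_eq a b x (d d' : mor x (dsys_D D a b x)) dd dd' :
  d = d' -> @DiffOb V D a b x d dd = @DiffOb V D a b x d' dd'.
Proof. by move=> e; subst d'; rewrite (Prop_irrelevance dd dd'). Qed.

Definition diff_coalgebra a b (X : Dc a b) : EM a b :=
  @Coalgebra _ (cc_cmd DG a b) (dob_ob X) (coact_of a b (dob_d X))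
    (sz_coact_e _ _) (proj2 (sz_coact_dP _ _) (dob_dd X)).

(** By the counit law the coaction is [sz_coact] of its second component, so coassociativity has the
    form treated in [sz_coact_dP]. *)
Lemma coalgebra_diff_dd a b (X : EM a b) :
  fmap (dsys_D D a b) (bp_p2 (sz_bp _ (dsys_D D a b) _) \oc coact X)
    \oc (bp_p2 (sz_bp (S _ _) (dsys_D D a b) _) \oc coact X) = 0.
Proof.
apply/(sz_coact_dP (S _ _)); rewrite sz_coact_p2; last exact: coact_e.
exact: coact_d.
Qed.

Definition coalgebra_diff a b (X : EM a b) : Dc a b :=
  DiffOb (coalgebra_diff_dd X).

Lemma diff_coalgebraK a b : cancel (@diff_coalgebra a b) (@coalgebra_diff a b).
Proof. by case=> x d dd; apply: diff_ob_eq; exact: p2_pair. Qed.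

Lemma coalgebra_diffK a b : cancel (@coalgebra_diff a b) (@diff_coalgebra a b).
Proof. by case=> x c ce cd; apply: coalgebra_eq; exact: sz_coact_p2. Qed.

Definition diff_coalg_hom a b (X Y : Dc a b) (t : mor X Y) :
    mor (diff_coalgebra X) (diff_coalgebra Y) :=
  @CoalgHom _ (cc_cmd DG a b) (diff_coalgebra X) (diff_coalgebra Y)
    (dhom_mor t) (proj2 (sz_coact_homP _ _ _ _) (dhom_morP t)).

Definition coalg_diff_hom a b (X Y : Dc a b)
    (t : mor (diff_coalgebra X) (diff_coalgebra Y)) : mor X Y :=
  @DiffHom _ _ _ _ X Y (coalg_mor t)
    (proj1 (sz_coact_homP _ _ _ _) (coalg_morP t)).

Lemma diff_coalg_hom_bij a b (X Y : Dc a b) :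
  bijective (@diff_coalg_hom a b X Y).
Proof.
exists (@coalg_diff_hom a b X Y) => t; first exact: diff_hom_eq.
exact: coalg_hom_eq.
Qed.

Definition diff_functor a b : functor (Dc a b) (EM a b).
Proof.
refine (@Functor (Dc a b) (EM a b) (@diff_coalgebra a b)
  (@diff_coalg_hom a b) _ _).
- by move=> X; apply: coalg_hom_eq.
- by move=> X Y Z g f; apply: coalg_hom_eq.
Defined.

(** * Horizontal composition and identities of differential pairs *)

Definition diff_comp_d a b c (X' : Dc b c) (X : Dc a b) :
    mor (dob_ob X' \ox dob_ob X) (dsys_D D a c (dob_ob X' \ox dob_ob X)) :=
  dsys_r D (dob_ob X') (dob_ob X) \oc (dob_d X' \ox2 idmor (dob_ob X))
  + dsys_l D (dob_ob X') (dob_ob X) \oc (idmor (dob_ob X') \ox2 dob_d X).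

(** The first row of [mu] gives the identity. In the second row the entry at [D g], [D f] is zero,
    which leaves one term with [l] and one with [r]. *)
Lemma sz_coact_comp a b c (X' : Dc b c) (X : Dc a b) :
  EM_coact (diff_coalgebra X') (diff_coalgebra X)
  = coact_of a c (diff_comp_d X' X).
Proof.
rewrite /EM_coact /= [LHS]pair_comp mcompDl -!mcompA -!hcomp2_M.
(* [dc_mu] lists the [l] term before the [r] term, hence [addrC]. *)
by rewrite !p1_pair !p2_pair hcomp2_1 addrC.
Qed.

(** [eta] is the first injection, so identities carry the zero differential. *)
Lemma sz_coact_id a : cc_eta DG a = coact_of a a 0.
Proof.
by rewrite /sz_coact /pair_mor mcompm1 mcomp0r addr0.
Qed.

(** This is coassociativity of the composite coalgebra. It rests on the compatibility of [d] with
    [mu], where the two mixed terms cancel by [dsys_dd]. *)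
Lemma diff_comp_dd a b c (X' : Dc b c) (X : Dc a b) :
  fmap (dsys_D D a c) (diff_comp_d X' X) \oc diff_comp_d X' X = 0.
Proof.
(* The equation does not mention direct sums, so [S] is supplied by hand to pass to coalgebras. *)
apply/(sz_coact_dP (S _ _)); rewrite -sz_coact_comp.
exact: (EM_coact_d (diff_coalgebra X') (diff_coalgebra X)).
Qed.

Definition diff_hcomp1 a b c (X' : Dc b c) (X : Dc a b) : Dc a c :=
  DiffOb (diff_comp_dd X' X).

Definition diff_id1 a : Dc a a :=
  @DiffOb _ D a a (id1 B (dsys_ob0 D a)) 0 (mcomp0r _ _).

Lemma diff_hcomp2_subproof a b c (Y Y' : Dc b c) (X X' : Dc a b)
    (t : mor Y Y') (s : mor X X') :
  fmap (dsys_D D a c) (dhom_mor t \ox2 dhom_mor s) \oc diff_comp_d Y X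
  = diff_comp_d Y' X' \oc (dhom_mor t \ox2 dhom_mor s).
Proof.
apply/(sz_coact_homP (S _ _)); rewrite -!sz_coact_comp.
exact: (EM_hcomp2_subproof (diff_coalg_hom t) (diff_coalg_hom s)).
Qed.

Definition diff_hcomp2 a b c (Y Y' : Dc b c) (X X' : Dc a b)
    (t : mor Y Y') (s : mor X X') :
    mor (diff_hcomp1 Y X) (diff_hcomp1 Y' X') :=
  @DiffHom _ _ _ _ (diff_hcomp1 Y X) (diff_hcomp1 Y' X') _
    (diff_hcomp2_subproof t s).

(** * Associativity and unit constraints on differential pairs *)

Lemma diff_inv_subproof a b (X Y : Dc a b) (f : mor (dob_ob X) (dob_ob Y))
    (g : mor (dob_ob Y) (dob_ob X)) :
  g \oc f = idmor _ -> f \oc g = idmor _ ->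
  fmap (dsys_D D a b) f \oc dob_d X = dob_d Y \oc f ->
  fmap (dsys_D D a b) g \oc dob_d Y = dob_d X \oc g.
Proof.
move=> gf fg /(sz_coact_homP (S _ _)) fP; apply/(sz_coact_homP (S _ _)).
exact: (@EM_inv_subproof _ _ _ DG _ _ (diff_coalgebra X) (diff_coalgebra Y)
  f g gf fg fP).
Qed.

(** [EM_hcomp1] stores its coaction as [mu] after the horizontal composite of the coactions, which
    has the form [sz_coact] only up to a proved equality. This lemma and the next three make that
    rewriting available for the constraints. *)
Lemma EM_coact_compl a b c d (Z : Dc c d) (Y : Dc b c) (X : Dc a b) :
  EM_coact (EM_hcomp1 (diff_coalgebra Z) (diff_coalgebra Y)) (diff_coalgebra X)
  = coact_of a d (diff_comp_d (diff_hcomp1 Z Y) X).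
Proof. by rewrite -sz_coact_comp /EM_coact /= sz_coact_comp. Qed.

Lemma EM_coact_compr a b c d (Z : Dc c d) (Y : Dc b c) (X : Dc a b) :
  EM_coact (diff_coalgebra Z) (EM_hcomp1 (diff_coalgebra Y) (diff_coalgebra X))
  = coact_of a d (diff_comp_d Z (diff_hcomp1 Y X)).
Proof. by rewrite -sz_coact_comp /EM_coact /= sz_coact_comp. Qed.

Lemma EM_coact_lunit a b (X : Dc a b) :
  EM_coact (@EM_id1 _ _ _ DG b) (diff_coalgebra X)
  = coact_of a b (diff_comp_d (diff_id1 b) X).
Proof. by rewrite -sz_coact_comp /EM_coact /= -sz_coact_id. Qed.

Lemma EM_coact_runit a b (X : Dc a b) :
  EM_coact (diff_coalgebra X) (@EM_id1 _ _ _ DG a)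
  = coact_of a b (diff_comp_d X (diff_id1 a)).
Proof. by rewrite -sz_coact_comp /EM_coact /= -sz_coact_id. Qed.

Lemma diff_assoc_subproof a b c d (Z : Dc c d) (Y : Dc b c) (X : Dc a b) :
  fmap (dsys_D D a d) (assoc B (dob_ob Z) (dob_ob Y) (dob_ob X))
    \oc diff_comp_d (diff_hcomp1 Z Y) X
  = diff_comp_d Z (diff_hcomp1 Y X)
    \oc assoc B (dob_ob Z) (dob_ob Y) (dob_ob X).
Proof.
apply/(sz_coact_homP (S _ _)); rewrite -EM_coact_compl -EM_coact_compr.
exact: (EM_assoc_subproof (diff_coalgebra Z) (diff_coalgebra Y)
  (diff_coalgebra X)).
Qed.

Lemma diff_lunit_subproof a b (X : Dc a b) :
  fmap (dsys_D D a b) (lunit B (dob_ob X)) \oc diff_comp_d (diff_id1 b) X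
  = dob_d X \oc lunit B (dob_ob X).
Proof.
apply/(sz_coact_homP (S _ _)); rewrite -EM_coact_lunit.
exact: (EM_lunit_subproof (diff_coalgebra X)).
Qed.

Lemma diff_runit_subproof a b (X : Dc a b) :
  fmap (dsys_D D a b) (runit B (dob_ob X)) \oc diff_comp_d X (diff_id1 a)
  = dob_d X \oc runit B (dob_ob X).
Proof.
apply/(sz_coact_homP (S _ _)); rewrite -EM_coact_runit.
exact: (EM_runit_subproof (diff_coalgebra X)).
Qed.

Definition diff_assoc a b c d (Z : Dc c d) (Y : Dc b c) (X : Dc a b) :
    mor (diff_hcomp1 (diff_hcomp1 Z Y) X) (diff_hcomp1 Z (diff_hcomp1 Y X)) :=
  @DiffHom _ _ _ _ (diff_hcomp1 (diff_hcomp1 Z Y) X)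
    (diff_hcomp1 Z (diff_hcomp1 Y X)) _ (diff_assoc_subproof Z Y X).

Definition diff_assocV a b c d (Z : Dc c d) (Y : Dc b c) (X : Dc a b) :
    mor (diff_hcomp1 Z (diff_hcomp1 Y X)) (diff_hcomp1 (diff_hcomp1 Z Y) X) :=
  @DiffHom _ _ _ _ (diff_hcomp1 Z (diff_hcomp1 Y X))
    (diff_hcomp1 (diff_hcomp1 Z Y) X) _
    (@diff_inv_subproof a d (diff_hcomp1 (diff_hcomp1 Z Y) X)
      (diff_hcomp1 Z (diff_hcomp1 Y X)) _ _
      (assocK B _ _ _) (assocVK B _ _ _) (diff_assoc_subproof Z Y X)).

Definition diff_lunit a b (X : Dc a b) : mor (diff_hcomp1 (diff_id1 b) X) X :=
  @DiffHom _ _ _ _ (diff_hcomp1 (diff_id1 b) X) X _ (diff_lunit_subproof X).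

Definition diff_lunitV a b (X : Dc a b) : mor X (diff_hcomp1 (diff_id1 b) X) :=
  @DiffHom _ _ _ _ X (diff_hcomp1 (diff_id1 b) X) _
    (@diff_inv_subproof a b (diff_hcomp1 (diff_id1 b) X) X _ _
      (lunitK B _) (lunitVK B _) (diff_lunit_subproof X)).

Definition diff_runit a b (X : Dc a b) : mor (diff_hcomp1 X (diff_id1 a)) X :=
  @DiffHom _ _ _ _ (diff_hcomp1 X (diff_id1 a)) X _ (diff_runit_subproof X).

Definition diff_runitV a b (X : Dc a b) : mor X (diff_hcomp1 X (diff_id1 a)) :=
  @DiffHom _ _ _ _ X (diff_hcomp1 X (diff_id1 a)) _
    (@diff_inv_subproof a b (diff_hcomp1 X (diff_id1 a)) X _ _
      (runitK B _) (runitVK B _) (diff_runit_subproof X)).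

(** * The bicategory of differential pairs and its isomorphism with that of coalgebras *)

Definition diff_bicategory :
  bicategory_on (fun a b : dsys_ob D => diff_category D a b).
Proof.
refine (@Bicategory _ (fun a b : dsys_ob D => diff_category D a b)
  diff_id1 diff_hcomp1 diff_hcomp2 _ _ diff_assoc diff_assocV _ _ _
  diff_lunit diff_lunitV _ _ _ diff_runit diff_runitV _ _ _ _ _);
  move=> *; apply: diff_hom_eq.
- exact: hcomp2_1.
- exact: hcomp2_M.
- exact: assocK.
- exact: assocVK.
- exact: assoc_nat.
- exact: lunitK.
- exact: lunitVK.
- exact: lunit_nat.
- exact: runitK.
- exact: runitVK.
- exact: runit_nat.
- exact: pentagon.
- exact: triangle.
Defined.

(** All structural 2-cells on both sides are those of [V], so each clause on composites or
    constraints reduces to comparing coactions. It is kept transparent so that its action can be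
    computed. *)
Definition diff_bicategory_iso :
  bicategory_iso diff_bicategory (EM_bicategory DG).
Proof.
refine (@BicategoryIso _ _ _ diff_bicategory (EM_bicategory DG)
  diff_functor _ _ _ _ _ _ _ _).
- by move=> a b; exists (@coalgebra_diff a b);
    [exact: diff_coalgebraK | exact: coalgebra_diffK].
- exact: diff_coalg_hom_bij.
- by move=> a; apply: coalgebra_eq; rewrite -sz_coact_id.
- by move=> a b c g f; apply: coalgebra_eq; rewrite -sz_coact_comp.
- by move=> a b c g g' f f' t s; apply: arr_coalg_hom_eq;
    rewrite -sz_coact_comp.
(* Source and target of the associator are both nested composites, so both coactions are compared; a
   unit constraint needs this at its source only. *)
- move=> a b c d h g f; apply: arr_coalg_hom_eq.
    by rewrite -EM_coact_compl.
  by rewrite -EM_coact_compr.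
- by move=> a b f; apply: arr_coalg_hom_eq; rewrite // -EM_coact_lunit.
- by move=> a b f; apply: arr_coalg_hom_eq; rewrite // -EM_coact_runit.
Defined.

End DifferentialBicategory.

(** The last two clauses make the identification canonical: [Phi] sends a pair to the coalgebra with
    coaction [(1, delta)] and keeps the underlying 2-cells. The clauses on composites and on [Phi]
    hold by computation. *)
Theorem proposition5p4
  (V : locally_additive_bicategory) (S : local_direct_sums V)
  (D : differential_system V) :
  exists W : bicategory_on (fun a b : dsys_ob D => diff_category D a b),
    (forall (a b c : dsys_ob D) (X' : diff_category D b c)
        (X : diff_category D a b),
      diff_pair (hcomp1 W X' X)
      = existT (fun x => mor x (dsys_D D a c x))
          (dob_ob X' \ox dob_ob X)
          (dsys_r D (dob_ob X') (dob_ob X) \oc (dob_d X' \ox2 idmor (dob_ob X))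
           + dsys_l D (dob_ob X') (dob_ob X)
             \oc (idmor (dob_ob X') \ox2 dob_d X))%R)
    /\
    exists Phi : bicategory_iso W (EM_bicategory (differential_comonad S D)),
      (forall (a b : dsys_ob D) (X : diff_category D a b),
        coalg_pair (Phi a b X)
        = existT (fun x => mor x (cc_cmd (differential_comonad S D) a b x))
            (dob_ob X)
            (pair_mor (sz_bp (S (dsys_ob0 D a) (dsys_ob0 D b))
                        (dsys_D D a b) (dob_ob X))
              (idmor (dob_ob X)) (dob_d X)))
      /\
      (forall (a b : dsys_ob D) (X Y : diff_category D a b) (t : mor X Y),
        arr (coalg_mor (fmap (Phi a b) t)) = arr (dhom_mor t)).
Proof.
exists (diff_bicategory S D); split=> [//|].
by exists (diff_bicategory_iso S D); split.
Qed.
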